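(* Let $n\ge1$ and $N=2^n$. Let $\rho_r$ and $\sigma_r$ be independent random full-rank density matrices on $\mathbb{C}^N$, each distributed according to the Hilbert–Schmidt measure, and let $U$ be a Haar-random unitary on $\mathbb{C}^N$. Let $V$ be any unitary on $\mathbb{C}^N$ (depending on $U,\rho_r,\sigma_r$) that is perfectly trained on the dataset $\mathcal D_2=\{(\rho_r,U\rho_rU^\dagger),(\sigma_r,U\sigma_rU^\dagger)\}$. Then $$\mathbb{E}_U\big[\mathbb{E}_{\mathcal D_2}[R_U(V)]\big]=0.$$
   Context: For unitaries $U,V$ on $\mathbb{C}^N$ the quantum risk is $$R_U(V)=1-\int |\langle\psi|U^\dagger V|\psi\rangle|^2\,d|\psi\rangle=1-\frac{N+|\operatorname{Tr}[U^\dagger V]|^2}{N(N+1)},$$ where the integral is over pure states with the uniform (Haar) probability measure. $V$ is perfectly trained on $\mathcal D_2$ if $V\rho_rV^\dagger=U\rho_rU^\dagger$ and $V\sigma_rV^\dagger=U\sigma_rU^\dagger$. The Hilbert–Schmidt measure on density matrices is the law of $AA^\dagger/\operatorname{Tr}[AA^\dagger]$, where $A$ is an $N\times N$ matrix with i.i.d. standard complex Gaussian entries (Ginibre ensemble); such a matrix is full rank almost surely. $\mathbb{E}_{\mathcal D_2}$ is the expectation over $\rho_r,\sigma_r$. *)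

(* Defs.v *)
From HB Require Import structures.
From mathcomp Require Import all_boot all_order all_algebra.
From mathcomp Require Import all_classical all_reals all_analysis.
From mathcomp Require Import complex.

Set Implicit Arguments.
Unset Strict Implicit.
Unset Printing Implicit Defensive.

Import Order.TTheory GRing.Theory Num.Theory.
Import numFieldNormedType.Exports.

Local Open Scope classical_set_scope.
Local Open Scope sesquilinear_scope.
Local Open Scope ring_scope.

HB.instance Definition _ (R : realType) := isPointed.Build R[i] 0.

(* The Borel sigma-algebra of the finite-dimensional real vector space
   'M[R[i]]_(m, n), presented as the one generated by the real and imaginary
   parts of the entries (as the library does for tuples). *)
Section measurable_complex_matrix.
Context (R : realType) (m n : nat).

(* [true] selects the real part, [false] the imaginary part. *)
Definition mx_coord (k : 'I_m * 'I_n * bool) (A : 'M[R[i]]_(m, n)) : R :=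
  if k.2 then complex.Re (A k.1.1 k.1.2) else complex.Im (A k.1.1 k.1.2).

Definition mx_measurable : set (set 'M[R[i]]_(m, n)) :=
  <<s \bigcup_(k in [set: 'I_m * 'I_n * bool])
        preimage_set_system setT (mx_coord k) measurable >>.

Let mx_measurable0 : mx_measurable set0.
Proof. exact: sigma_algebra0. Qed.

Let mx_measurableC A : mx_measurable A -> mx_measurable (~` A).
Proof. exact: sigma_algebraC. Qed.

Let mx_measurable_bigcup (F : (set 'M[R[i]]_(m, n))^nat) :
  (forall i, mx_measurable (F i)) -> mx_measurable (\bigcup_i F i).
Proof. exact: sigma_algebra_bigcup. Qed.

HB.instance Definition _ := @isMeasurable.Build default_measure_display
  'M[R[i]]_(m, n) mx_measurable mx_measurable0 mx_measurableC
  mx_measurable_bigcup.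

End measurable_complex_matrix.

Section quantum.
Context (R : realType).

(* Left-invariance suffices: a left Haar measure on a compact group is
   bi-invariant. *)
Definition haar_unitary N (mu : probability 'M[R[i]]_N R) : Prop :=
  mu [set U | U \is unitarymx] = 1%E /\
  forall (W : 'M[R[i]]_N) (S : set 'M[R[i]]_N),
    W \is unitarymx -> measurable S ->
    mu ((fun U => W *m U) @^-1` S) = mu S.

(* A pure state is represented by a unit vector; as the risk only involves
   |<psi|W|psi>|, the global phase is irrelevant. *)
Definition haar_pure_state N (om : probability 'cV[R[i]]_N R) : Prop :=
  om [set psi | psi^t* *m psi = 1%:M] = 1%E /\
  forall (W : 'M[R[i]]_N) (S : set 'cV[R[i]]_N),
    W \is unitarymx -> measurable S ->
    om ((fun psi => W *m psi) @^-1` S) = om S.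

(* [om] is meant to be the uniform measure, i.e. to satisfy
   [haar_pure_state om]. *)
Definition quantum_risk N (om : probability 'cV[R[i]]_N R)
    (U V : 'M[R[i]]_N) : R :=
  1 - \int[om]_psi (Normc.normc ((psi^t* *m U^t* *m V *m psi) 0 0) ^+ 2).

Definition mutually_independent d d' (T : measurableType d)
    (T' : measurableType d') (P : probability T R) (I : finType)
    (X : I -> T -> T') : Prop :=
  forall (J : {set I}) (B : I -> set T'), (forall i, measurable (B i)) ->
    P (\bigcap_(i in [set` J]) (X i @^-1` B i)) =
    (\prod_(i in J) P (X i @^-1` B i))%E.

(* Law of an N x N matrix with i.i.d. standard complex Gaussian entries.  A
   standard complex Gaussian z (with E|z|^2 = 1) has independent real and
   imaginary parts of law N(0, 1/2); [normal_prob] takes the standard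
   deviation as parameter. *)
Definition ginibre N (G : probability 'M[R[i]]_N R) : Prop :=
  mutually_independent G (@mx_coord R N N) /\
  forall (k : 'I_N * 'I_N * bool) (B : set R), measurable B ->
    G (mx_coord k @^-1` B) = normal_prob 0 (Num.sqrt 2^-1) B.

Definition normalized_gram N (A : 'M[R[i]]_N) : 'M[R[i]]_N :=
  (\tr (A *m A^t*))^-1 *: (A *m A^t*).

Definition hilbert_schmidt N (mu : probability 'M[R[i]]_N R) : Prop :=
  exists2 G : probability 'M[R[i]]_N R, ginibre G &
    forall S : set 'M[R[i]]_N, measurable S ->
      mu S = pushforward G (@normalized_gram N) S.

(* [0 <= z] on R[i] means that z is real and nonnegative. *)
Definition density_matrix N (rho : 'M[R[i]]_N) : Prop :=
  [/\ rho^t* = rho,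
      forall psi : 'cV[R[i]]_N, 0 <= (psi^t* *m rho *m psi) 0 0 &
      \tr rho = 1].

Definition full_rank_density N (rho : 'M[R[i]]_N) : Prop :=
  density_matrix rho /\ \rank rho = N.

Definition perfectly_trained N (U rho sigma V : 'M[R[i]]_N) : Prop :=
  V *m rho *m V^t* = U *m rho *m U^t* /\
  V *m sigma *m V^t* = U *m sigma *m U^t*.

End quantum.

(* Main.v *)
From HB Require Import structures.
Require Import Defs.
From mathcomp Require Import all_boot all_order all_algebra.
From mathcomp Require Import all_classical all_reals all_analysis.
From mathcomp Require Import measurable_realfun complex ring.
From mathcomp Require polyrcf.

(* Write W = U^* V.  Perfect training says that W commutes with rho and sigma,
   and the risk vanishes as soon as W is a phase.  The N^2 words
   rho^i sigma rho^j (i, j < N) span all N x N matrices unless a determinant,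
   polynomial in the entries of rho and sigma, vanishes; when they span, W is
   central, hence scalar.  That determinant is not identically zero: it is
   nonzero when rho is diagonal with distinct eigenvalues and sigma has constant
   nonzero entries, and both occur as Gram matrices.  A polynomial that is not
   identically zero vanishes with Gaussian probability zero, by resampling the
   real coordinates one at a time; hence almost every pair (rho, sigma) is
   generic.  As V need not be measurable, integrals are only computed for
   functions vanishing outside a measurable null set. *)

Set Implicit Arguments.
Unset Strict Implicit.
Unset Printing Implicit Defensive.

Import Order.TTheory GRing.Theory Num.Theory.

Local Open Scope classical_set_scope.
Local Open Scope sesquilinear_scope.
Local Open Scope ring_scope.

(** * Integrals of functions supported on null sets *)

Section null_sets.
Context d (T : measurableType d) (R : realType).

Import HBNNSimple.

(** The integral is a difference of suprema over simple functions lying below the positive and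
    negative parts of [f]. Each such simple function is measurable and vanishes outside [N], so it
    integrates to zero. Hence [f] itself need not be measurable. *)
Lemma integral_null_support (mu : {measure set T -> \bar R}) (N : set T)
    (f : T -> \bar R) :
  measurable N -> mu N = 0%E -> (forall x, ~ N x -> f x = 0%E) ->
  (\int[mu]_x f x = 0)%E.
Proof.
move=> mN N0 f0.
have nn0 (g : T -> \bar R) : (forall x, (0 <= g x)%E) ->
    (forall x, ~ N x -> g x = 0%E) -> (\int[mu]_x g x = 0)%E.
  move=> g0 gN; rewrite ge0_integralTE//; apply/eqP; rewrite eq_le.
  apply/andP; split; last first.
    apply: ereal_sup_ubound; exists nnsfun0; last exact: sintegral0.
    by move=> x /=; exact: g0.
  apply: ge_ereal_sup => /= _ [h /= hg <-].
  have mh : measurable_fun setT (fun x => (h x)%:E) by exact/measurable_EFinP.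
  rewrite -integralT_nnsfun (ge0_negligible_integral mN)//; last first.
    by move=> x _; rewrite /= lee_fin.
  rewrite integral0_eq// => x [_ /gN gx].
  apply/le_anti/andP; split; last by rewrite lee_fin.
  by rewrite -gx; exact: hg.
rewrite integralE [X in (X - _)%E]nn0 1?[X in (_ - X)%E]nn0 ?sube0//;
  move=> x /f0 fx.
- by rewrite funenegE fx oppe0 maxxx.
- by rewrite funeposE fx maxxx.
Qed.

Lemma probability_setC_eq0 (P : probability T R) (A : set T) :
  measurable A -> P A = 1%E -> P (~` A) = 0%E.
Proof. by move=> mA A1; rewrite probability_setC ?A1 ?subee. Qed.

End null_sets.

(** * Real coordinates of complex matrices *)

Section complex_matrix_coordinates.
Context (R : realType).
Implicit Types m n : nat.

Definition mx_update m n (k : 'I_m * 'I_n * bool) (A : 'M[R[i]]_(m, n))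
    (t : R) : 'M[R[i]]_(m, n) :=
  \matrix_(i, j) (if (i, j) == k.1 then
                    if k.2 then Complex t (complex.Im (A i j))
                    else Complex (complex.Re (A i j)) t
                  else A i j).

Lemma mx_coord_update m n (k l : 'I_m * 'I_n * bool) (A : 'M[R[i]]_(m, n))
    (t : R) :
  mx_coord l (mx_update k A t) = if l == k then t else mx_coord l A.
Proof.
case: k l => [[i j] b] [[i' j'] b']; rewrite /mx_coord mxE /=.
rewrite !xpair_eqE; case: eqP => //= ->; case: eqP => //= ->.
by case: b b' => [] [].
Qed.

Lemma mx_coord_inj m n (A B : 'M[R[i]]_(m, n)) :
  (forall k, mx_coord k A = mx_coord k B) -> A = B.
Proof.
move=> AB; apply/matrixP => i j.
have := AB (i, j, true); have := AB (i, j, false); rewrite /mx_coord /=.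
by case: (A i j) (B i j) => a b [a' b'] /= -> ->.
Qed.

Lemma mx_update_id m n (k : 'I_m * 'I_n * bool) (A : 'M[R[i]]_(m, n)) :
  mx_update k A (mx_coord k A) = A.
Proof.
by apply: mx_coord_inj => l; rewrite mx_coord_update; case: eqP => // ->.
Qed.

Lemma measurable_mx_coord m n (k : 'I_m * 'I_n * bool) :
  measurable_fun [set: 'M[R[i]]_(m, n)] (mx_coord k).
Proof.
move=> _ B mB; apply: sub_sigma_algebra; exists k => //.
by exists B.
Qed.

Lemma measurable_fun_mx d (T : measurableType d) m n
    (f : T -> 'M[R[i]]_(m, n)) :
  (forall k, measurable_fun setT (mx_coord k \o f)) -> measurable_fun setT f.
Proof.
move=> mf; pose G := \bigcup_(k in [set: 'I_m * 'I_n * bool])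
  preimage_set_system setT (@mx_coord R m n k) measurable.
apply: (@measurability _ _ _ _ setT f G) => //.
move=> _ [_ [k _ [B mB <-]] <-].
rewrite !setTI -comp_preimage -[X in measurable X]setTI.
exact: mf.
Qed.

Lemma measurable_mx_update m n (k : 'I_m * 'I_n * bool) :
  measurable_fun setT (fun x : 'M[R[i]]_(m, n) * R => mx_update k x.1 x.2).
Proof.
apply: measurable_fun_mx => l; rewrite /comp.
under eq_fun do rewrite mx_coord_update.
case: eqP => _; first exact: measurable_snd.
exact: (measurableT_comp (measurable_mx_coord l) measurable_fst).
Qed.

End complex_matrix_coordinates.

(** * Resampling one coordinate of a Ginibre matrix *)

Section resampling.
Context (R : realType) (N : nat) (G : probability 'M[R[i]]_N R).
Hypothesis hG : ginibre G.

Let gauss := normal_prob (0 : R) (Num.sqrt 2^-1).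
Let mx_box (B : 'I_N * 'I_N * bool -> set R) : set 'M[R[i]]_N :=
  [set A | forall k, B k (mx_coord k A)].

Let mx_boxE B :
  mx_box B = \bigcap_(k in [set` [set: 'I_N * 'I_N * bool]%SET])
               (@mx_coord R N N k @^-1` B k).
Proof.
apply/seteqP; split => A /= AB k; first by move=> _; exact: AB.
by apply: AB; rewrite /= inE.
Qed.

Let ginibre_box B : (forall k, measurable (B k)) ->
  G (mx_box B) = (\prod_k gauss (B k))%E.
Proof.
move=> mB; rewrite mx_boxE hG.1//.
by apply: eq_big => [k|k _]; rewrite ?inE// hG.2.
Qed.

(** The coordinates are independent, so replacing the [k]-th by a fresh Gaussian preserves the law.
    Integrating over the fresh value first reduces null sets in many variables to null sets on
    lines. *)
Lemma ginibre_resample (k : 'I_N * 'I_N * bool) (Z : set 'M[R[i]]_N) :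
  measurable Z ->
  G Z = (\int[G]_A gauss [set t | Z (mx_update k A t)])%E.
Proof.
move=> mZ.
have mu : measurable_fun setT
    (fun x : 'M[R[i]]_N * R => mx_update k x.1 x.2).
  exact: measurable_mx_update.
pose P := (G \x gauss)%E.
pose H := pushforward P (fun x : 'M[R[i]]_N * R => mx_update k x.1 x.2).
have -> : (\int[G]_A gauss [set t | Z (mx_update k A t)])%E = H Z.
  rewrite /H /pushforward /P /product_measure1; apply: eq_integral => A _ /=.
  congr (gauss _); apply/seteqP; split => t;
    by rewrite /xsection /= ?inE.
(* Boxes are stable under intersection and generate the sigma-algebra, so two probability measures
   that agree on them are equal. *)
pose C := [set mx_box B | B in [set B | forall k, measurable (B k)]].
have mbox B : (forall k, measurable (B k)) -> measurable (mx_box B).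
  move=> mB; rewrite mx_boxE; apply: fin_bigcap_measurable => // l _.
  by rewrite -[X in measurable X]setTI; exact: measurable_mx_coord.
have boxT : mx_box (fun=> setT) = setT by apply/seteqP; split.
apply: (@measure_unique _ R _ C (fun=> setT)) => //.
- apply/seteqP; split.
    apply: smallest_sub; first exact: smallest_sigma_algebra.
    move=> _ [l _ [B mB <-]]; apply: sub_sigma_algebra.
    exists (fun l' => if l' == l then B else setT).
      by move=> l' /=; case: ifP.
    rewrite setTI; apply/seteqP; split => A /=.
      by move=> /(_ l); rewrite eqxx.
    by move=> Bl l'; case: eqP => // ->.
  apply: smallest_sub; first exact: sigma_algebra_measurable.
  by move=> _ [B mB <-]; exact: mbox.
- move=> _ _ [B mB <-] [B' mB' <-]; exists (fun l => B l `&` B' l).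
    by move=> l; exact: measurableI.
  apply/seteqP; split => A /=.
    by move=> h; split => l; have [] := h l.
  by move=> [h h'] l; split.
- by move=> _; rewrite -boxT; exists (fun=> setT).
- by rewrite bigcup_const.
- move=> _ [B mB <-]; rewrite /= /H /pushforward.
  (* The updated matrix forgets the old [k]-th coordinate: its membership in a box constrains the
     other old coordinates and the fresh value separately. *)
  pose B' l := if l == k then setT else B l.
  have mB' l : measurable (B' l) by rewrite /B'; case: ifP.
  have -> : (fun x : 'M[R[i]]_N * R => mx_update k x.1 x.2) @^-1` mx_box B =
      mx_box B' `*` B k.
    apply/seteqP; split => -[A t] /=.
      move=> h; split; last by have := h k; rewrite mx_coord_update eqxx.
      by move=> l; have := h l; rewrite mx_coord_update /B'; case: eqP.
    move=> [h Bt] l; have := h l; rewrite mx_coord_update /B'.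
    by case: eqP => // ->.
  transitivity (G (mx_box B') * gauss (B k))%E; last first.
    by apply/esym; apply: product_measure1E; [exact: mbox|exact: mB].
  rewrite (ginibre_box mB) (ginibre_box mB').
  rewrite (bigD1 k)//= [in RHS](bigD1 k)//=.
  have gT : gauss setT = 1%E by exact: probability_setT.
  rewrite /B' eqxx gT mul1e muleC; congr (_ * _)%E.
  by apply: eq_bigr => l /negbTE ->.
- by move=> _; rewrite [X in (X < _)%E](probability_setT G) ltry.
Qed.

Lemma normal_prob_finite_set (s : seq R) : gauss [set` s] = 0%E.
Proof.
have /null_content_dominatesP h := @normal_prob_dominates R 0 (Num.sqrt 2^-1).
apply: h; last first.
  by apply: countable_lebesgue_measure0; exact/finite_set_countable/finite_seq.
rewrite -[X in measurable X]image_id -bigcup_imset1.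
apply: fin_bigcup_measurable => [|x _]; first exact: finite_seq.
exact: measurable_set1.
Qed.
End resampling.

(** * Real polynomial functions of the coordinates and their zero sets *)

Section polynomial_functions.
Context (R : realType).
Implicit Types m n : nat.

(** Polynomials are represented as functions with an inductive certificate: measurability and
    restriction to a line then follow by induction on it. *)
Inductive mx_poly m n : ('M[R[i]]_(m, n) -> R) -> Prop :=
| mx_poly_cst c : mx_poly (fun=> c)
| mx_poly_coord k : mx_poly (mx_coord k)
| mx_polyD f g : mx_poly f -> mx_poly g -> mx_poly (fun A => f A + g A)
| mx_polyM f g : mx_poly f -> mx_poly g -> mx_poly (fun A => f A * g A).

Lemma measurable_mx_poly m n (f : 'M[R[i]]_(m, n) -> R) :
  mx_poly f -> measurable_fun setT f.
Proof.
elim=> {f} [c|k|f g _ mf _ mg|f g _ mf _ mg].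
- exact: measurable_cst.
- exact: measurable_mx_coord.
- exact: measurable_funD.
- exact: measurable_funM.
Qed.

Lemma mx_poly_update m n (f : 'M[R[i]]_(m, n) -> R) k t :
  mx_poly f -> mx_poly (fun A => f (mx_update k A t)).
Proof.
elim=> {f} [c|l|f g _ pf _ pg|f g _ pf _ pg].
- exact: mx_poly_cst.
- have [->|lk] := eqVneq l k.
    by under eq_fun do rewrite mx_coord_update eqxx; exact: mx_poly_cst.
  under eq_fun do rewrite mx_coord_update (negbTE lk).
  exact: mx_poly_coord.
- exact: mx_polyD.
- exact: mx_polyM.
Qed.

Lemma mx_poly_slice m n (f : 'M[R[i]]_(m, n) -> R) k A :
  mx_poly f -> exists p : {poly R}, forall t, f (mx_update k A t) = p.[t].
Proof.
elim=> {f} [c|l|f g _ [p fp] _ [q gq]|f g _ [p fp] _ [q gq]].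
- by exists c%:P => t; rewrite hornerC.
- have [->|lk] := eqVneq l k.
    by exists 'X => t; rewrite mx_coord_update eqxx hornerX.
  by exists (mx_coord l A)%:P => t; rewrite mx_coord_update (negbTE lk) hornerC.
- by exists (p + q) => t; rewrite hornerD fp gq.
- by exists (p * q) => t; rewrite hornerM fp gq.
Qed.

Lemma mx_poly_sum m n (I : Type) (r : seq I) (P : pred I)
    (F : I -> 'M[R[i]]_(m, n) -> R) :
  (forall i, mx_poly (F i)) -> mx_poly (fun A => \sum_(i <- r | P i) F i A).
Proof.
move=> pF; elim: r => [|i r IH].
  by under eq_fun do rewrite big_nil; exact: mx_poly_cst.
under eq_fun do rewrite big_cons.
by case: (P i) => //; exact: mx_polyD.
Qed.

Lemma measurable_mx_poly_eq m n (f : 'M[R[i]]_(m, n) -> R) (c : R) :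
  mx_poly f -> measurable [set A | f A = c].
Proof.
move=> /measurable_mx_poly mf.
rewrite (_ : [set A | _] = setT `&` f @^-1` [set c]); last first.
  by rewrite setTI.
by apply: mf => //; exact: measurable_set1.
Qed.

Lemma measurable_mx_poly_ge0 m n (f : 'M[R[i]]_(m, n) -> R) :
  mx_poly f -> measurable [set A | 0 <= f A].
Proof.
move=> /measurable_mx_poly mf.
rewrite (_ : [set A | _] = setT `&` f @^-1` `[0, +oo[); last first.
  by rewrite setTI; apply/seteqP; split=> A; rewrite /= in_itv /= andbT.
by apply: mf => //; exact: measurable_itv.
Qed.

(* Fixing one coordinate at its value in [A0] leaves a polynomial that is
   nonzero at [A0]; wherever that one does not vanish, the slice through the
   coordinate is a nonzero polynomial of one variable, with finitely many
   roots. *)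
Lemma ginibre_mx_poly_eq0 N (G : probability 'M[R[i]]_N R)
    (f : 'M[R[i]]_N -> R) (A0 : 'M[R[i]]_N) :
  ginibre G -> mx_poly f -> f A0 != 0 -> G [set A | f A = 0] = 0%E.
Proof.
move=> hG.
(* [s] lists the coordinates on which [g] may depend; the induction removes them one at a time until
   [g] is constant. *)
suff H (s : seq ('I_N * 'I_N * bool)) g : mx_poly g -> g A0 != 0 ->
    (forall A B, (forall k, k \in s -> mx_coord k A = mx_coord k B) ->
       g A = g B) -> G [set A | g A = 0] = 0%E.
  move=> pf f0; apply: (H (enum {: 'I_N * 'I_N * bool})) => // A B AB.
  by congr f; apply: mx_coord_inj => k; apply: AB; rewrite mem_enum.
elim: s g => [|k s IH] g pg g0 gs.
  rewrite (_ : [set A | _] = set0) ?measure0//; apply/seteqP; split => A //= gA.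
  by move: g0; rewrite (gs A0 A)// gA eqxx.
pose h A := g (mx_update k A (mx_coord k A0)).
have ph : mx_poly h by exact: mx_poly_update.
have h0 : h A0 != 0 by rewrite /h mx_update_id.
have hZ : G [set A | h A = 0] = 0%E.
  apply: IH => // A B AB; apply: gs => l; rewrite inE !mx_coord_update.
  by case: eqP => //= _; exact: AB.
rewrite (ginibre_resample hG k); last exact: measurable_mx_poly_eq.
apply: (integral_null_support _ hZ); first exact: measurable_mx_poly_eq.
move=> A /= hA; have [p gp] := mx_poly_slice k A pg.
have p0 : p != 0.
  by apply/negP => /eqP p0; apply: hA; rewrite /h gp p0 horner0.
rewrite (_ : [set t | _] = [set` polyrcf.rootsR p]).
  exact: normal_prob_finite_set.
apply/seteqP; split => t /=; rewrite gp -(polyrcf.roots_on_rootsR p0) in_itv /=.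
  by move=> /eqP.
by move=> /eqP.
Qed.

(** By continuity a negative value would persist at a nearby rational point. *)
Lemma poly_ge0_rat (p : {poly R}) :
  (forall q : rat, 0 <= p.[ratr q]) -> forall t, 0 <= p.[t].
Proof.
move=> p0 t; rewrite leNgt; apply/negP => pt.
have e0 : 0 < - p.[t] by rewrite oppr_gt0.
have [d d0 pd] := polyrcf.poly_cont t p e0.
have [q] : exists q : rat, ratr q \in `]t, (t + d)[.
  by apply: rat_in_itvoo; rewrite ltrDl.
rewrite in_itv /= => /andP[tq qd].
have := pd (ratr q); rewrite gtr0_norm ?subr_gt0// ltrBlDl => /(_ qd).
rewrite ltr_norml => /andP[_]; rewrite ltrBlDr addNr.
by rewrite ltNge p0.
Qed.

(** This reduces positivity of a quadratic form to countably many test vectors. *)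
Lemma mx_poly_ge0_rat m n (f : 'M[R[i]]_(m, n) -> R) :
  mx_poly f ->
  (forall A, (forall k, exists q : rat, mx_coord k A = ratr q) -> 0 <= f A) ->
  forall A, 0 <= f A.
Proof.
move=> pf f0.
(* [s] lists the coordinates that may be irrational; the one-variable case frees them one after
   another. *)
suff H (s : seq ('I_m * 'I_n * bool)) A :
    (forall k, k \notin s -> exists q : rat, mx_coord k A = ratr q) -> 0 <= f A.
  by move=> A; apply: (H (enum {: 'I_m * 'I_n * bool})) => k; rewrite mem_enum.
elim: s A => [|k s IH] A As; first by apply: f0 => k; exact: As.
have [p fp] := mx_poly_slice k A pf.
rewrite -(mx_update_id k A) fp; apply: poly_ge0_rat => q.
rewrite -fp; apply: IH => l ls; rewrite mx_coord_update.
case: eqP => [_|/eqP lk]; first by exists q.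
by apply: As; rewrite inE negb_or lk.
Qed.

End polynomial_functions.

(** * Complex and matrix-valued polynomial functions *)

Section complex_polynomial_functions.
Context (R : realType) (m n : nat).
Local Notation T := 'M[R[i]]_(m, n).

Definition cmx_poly (F : T -> R[i]) : Prop :=
  mx_poly (fun A => complex.Re (F A)) /\ mx_poly (fun A => complex.Im (F A)).

Lemma cmx_poly_cst c : cmx_poly (fun=> c).
Proof. by split; exact: mx_poly_cst. Qed.

Lemma cmx_poly_entry i j : cmx_poly (fun A => A i j).
Proof.
split; first exact: (@mx_poly_coord R m n (i, j, true)).
exact: (@mx_poly_coord R m n (i, j, false)).
Qed.

Lemma cmx_polyD F G : cmx_poly F -> cmx_poly G -> cmx_poly (fun A => F A + G A).
Proof.
move=> [F1 F2] [G1 G2]; split.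
- rewrite (_ : (fun _ => _) = fun A => complex.Re (F A) + complex.Re (G A)).
    exact: mx_polyD.
  by apply/funext => A; case: (F A) (G A) => ? ? [].
- rewrite (_ : (fun _ => _) = fun A => complex.Im (F A) + complex.Im (G A)).
    exact: mx_polyD.
  by apply/funext => A; case: (F A) (G A) => ? ? [].
Qed.

Lemma mx_polyN (f : T -> R) : mx_poly f -> mx_poly (fun A => - f A).
Proof.
move=> pf; under eq_fun do rewrite -mulN1r.
by apply: mx_polyM => //; exact: mx_poly_cst.
Qed.

Lemma cmx_polyM F G : cmx_poly F -> cmx_poly G -> cmx_poly (fun A => F A * G A).
Proof.
move=> [F1 F2] [G1 G2]; split.
- rewrite (_ : (fun _ => _) = fun A => complex.Re (F A) * complex.Re (G A) +
      - (complex.Im (F A) * complex.Im (G A))).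
    by apply: mx_polyD; [|apply: mx_polyN]; exact: mx_polyM.
  by apply/funext => A; case: (F A) (G A) => ? ? [].
- rewrite (_ : (fun _ => _) = fun A => complex.Re (F A) * complex.Im (G A) +
      complex.Im (F A) * complex.Re (G A)).
    by apply: mx_polyD; exact: mx_polyM.
  by apply/funext => A; case: (F A) (G A) => ? ? [].
Qed.

Lemma cmx_poly_conj F : cmx_poly F -> cmx_poly (fun A => (F A)^*).
Proof.
move=> [F1 F2]; split.
- rewrite (_ : (fun _ => _) = fun A => complex.Re (F A))//.
  by apply/funext => A; case: (F A).
- rewrite (_ : (fun _ => _) = fun A => - complex.Im (F A)).
    exact: mx_polyN.
  by apply/funext => A; case: (F A).
Qed.

Lemma cmx_poly_sum (I : Type) (r : seq I) (P : pred I) (F : I -> T -> R[i]) :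
  (forall i, cmx_poly (F i)) -> cmx_poly (fun A => \sum_(i <- r | P i) F i A).
Proof.
move=> pF; elim: r => [|i r IH].
  by under eq_fun do rewrite big_nil; exact: cmx_poly_cst.
under eq_fun do rewrite big_cons.
by case: (P i) => //; exact: cmx_polyD.
Qed.

Lemma cmx_poly_prod (I : Type) (r : seq I) (P : pred I) (F : I -> T -> R[i]) :
  (forall i, cmx_poly (F i)) -> cmx_poly (fun A => \prod_(i <- r | P i) F i A).
Proof.
move=> pF; elim: r => [|i r IH].
  by under eq_fun do rewrite big_nil; exact: cmx_poly_cst.
under eq_fun do rewrite big_cons.
by case: (P i) => //; exact: cmx_polyM.
Qed.

Definition mxfun_poly p q (F : T -> 'M[R[i]]_(p, q)) : Prop :=
  forall i j, cmx_poly (fun A => F A i j).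

Lemma mxfun_poly_id : mxfun_poly (fun A => A).
Proof. exact: cmx_poly_entry. Qed.

Lemma mxfun_poly_cst p q (B : 'M[R[i]]_(p, q)) : mxfun_poly (fun=> B).
Proof. by move=> i j; exact: cmx_poly_cst. Qed.

Lemma mxfun_polyM p q r (F : T -> 'M[R[i]]_(p, q)) (H : T -> 'M[R[i]]_(q, r)) :
  mxfun_poly F -> mxfun_poly H -> mxfun_poly (fun A => F A *m H A).
Proof.
move=> pF pH i j; under eq_fun do rewrite mxE.
by apply: cmx_poly_sum => k; exact: cmx_polyM.
Qed.

Lemma mxfun_poly_ctrmx p q (F : T -> 'M[R[i]]_(p, q)) :
  mxfun_poly F -> mxfun_poly (fun A => map_mx Num.conj (F A)^T).
Proof.
by move=> pF i j; under eq_fun do rewrite !mxE; exact: cmx_poly_conj.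
Qed.

Lemma mxfun_polyX p (F : T -> 'M[R[i]]_p) k :
  mxfun_poly F -> mxfun_poly (fun A => F A ^+ k).
Proof.
move=> pF; elim: k => [|k IH].
  by under eq_fun do rewrite expr0; exact: mxfun_poly_cst.
by under eq_fun do rewrite exprS; exact: mxfun_polyM.
Qed.

Lemma cmx_poly_det p (F : T -> 'M[R[i]]_p) :
  mxfun_poly F -> cmx_poly (fun A => \det (F A)).
Proof.
move=> pF; apply: cmx_poly_sum => s; apply: cmx_polyM.
  exact: cmx_poly_cst.
by apply: cmx_poly_prod => i.
Qed.

Lemma cmx_poly_tr p (F : T -> 'M[R[i]]_p) :
  mxfun_poly F -> cmx_poly (fun A => \tr (F A)).
Proof. by move=> pF; apply: cmx_poly_sum => i. Qed.

(** The squared modulus turns one complex equation [F A = 0] into one real polynomial equation. *)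
Lemma cmx_poly_sqr_normc F : cmx_poly F ->
  mx_poly (fun A => complex.Re (F A) ^+ 2 + complex.Im (F A) ^+ 2).
Proof. by move=> [F1 F2]; apply: mx_polyD; exact: mx_polyM. Qed.

Lemma sqr_normc_eq0 (z : R[i]) :
  (complex.Re z ^+ 2 + complex.Im z ^+ 2 == 0) = (z == 0).
Proof.
by case: z => a b /=; rewrite paddr_eq0 ?sqr_ge0// !sqrf_eq0 eq_complex.
Qed.

Lemma measurable_cmx_poly_eq F c : cmx_poly F -> measurable [set A | F A = c].
Proof.
move=> pF; have /cmx_poly_sqr_normc pFc : cmx_poly (fun A => F A + (- c)).
  by apply: cmx_polyD => //; exact: cmx_poly_cst.
rewrite (_ : [set A | _] = [set A |
    complex.Re (F A + - c) ^+ 2 + complex.Im (F A + - c) ^+ 2 = 0]).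
  exact: measurable_mx_poly_eq.
apply/seteqP; split => A FA.
  by apply/eqP; rewrite sqr_normc_eq0 subr_eq0; exact/eqP.
by move: FA => /eqP; rewrite sqr_normc_eq0 subr_eq0 => /eqP.
Qed.

Lemma measurable_mxfun_poly_eq p q (F : T -> 'M[R[i]]_(p, q)) B :
  mxfun_poly F -> measurable [set A | F A = B].
Proof.
move=> pF; rewrite (_ : [set A | _] = \bigcap_(k in [set: 'I_p * 'I_q])
    [set A | F A k.1 k.2 = B k.1 k.2]); last first.
  apply/seteqP; split => A /=; first by move=> FA k _ /=; rewrite FA.
  by move=> AB; apply/matrixP => i j; exact: (AB (i, j)).
by apply: fin_bigcap_measurable => // k _; exact: measurable_cmx_poly_eq.
Qed.

End complex_polynomial_functions.

Lemma ginibre_cmx_poly_eq0 (R : realType) N (G : probability 'M[R[i]]_N R)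
    (F : 'M[R[i]]_N -> R[i]) (A0 : 'M[R[i]]_N) :
  ginibre G -> cmx_poly F -> F A0 != 0 -> G [set A | F A = 0] = 0%E.
Proof.
move=> hG /cmx_poly_sqr_normc pF F0.
rewrite -[RHS](ginibre_mx_poly_eq0 (A0 := A0) hG pF) ?sqr_normc_eq0//.
by congr (G _); apply/seteqP; split => A /eqP FA; apply/eqP;
  rewrite ?sqr_normc_eq0// -sqr_normc_eq0.
Qed.

(** * Words in two matrices and their commutant *)

Section sandwich_words.
Context (F : fieldType) (N : nat).
Implicit Types (rho sigma C W : 'M[F]_N).

(** [C] is the coefficient matrix of a linear combination of the words, so that [sandwich rho sigma]
    is an endomorphism of the matrix space and has a determinant, nonzero exactly when the words
    form a basis. *)
Definition sandwich rho sigma C : 'M[F]_N :=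
  \sum_i \sum_j C i j *: (rho ^+ i *m sigma *m rho ^+ j).

Lemma sandwich_is_linear rho sigma : linear (sandwich rho sigma).
Proof.
move=> a C D; rewrite /sandwich scaler_sumr -big_split; apply: eq_bigr => i _.
rewrite scaler_sumr -big_split; apply: eq_bigr => j _.
by rewrite !mxE scalerDl scalerA.
Qed.

HB.instance Definition _ rho sigma := GRing.isLinear.Build F 'M[F]_N 'M[F]_N
  _ (sandwich rho sigma) (sandwich_is_linear rho sigma).

Definition sandwich_det rho sigma : F := \det (lin_mx (sandwich rho sigma)).

Lemma sandwich_detP rho sigma :
  sandwich_det rho sigma != 0 <->
  (forall C, sandwich rho sigma C = 0 -> C = 0).
Proof.
rewrite -unitfE -unitmxE -row_free_unit; split => [/row_free_inj inj C C0|inj].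
  apply: (can_inj mxvecK); apply: inj.
  by rewrite /= mul_vec_lin [X in mxvec X]C0 !linear0 mul0mx.
apply: inj_row_free => v; rewrite mul_rV_lin => /(canRL mxvecK).
by rewrite linear0 => /inj /(canRL vec_mxK); rewrite linear0.
Qed.

Lemma scalar_mx_commute W :
  (forall B, W *m B = B *m W) -> exists c, W = c%:M.
Proof.
move=> WB.
have [j|noN] := pickP (fun _ : 'I_N => true); last first.
  by exists 0; apply/matrixP => i; have := noN i.
move=> _; exists (W j j); apply/matrixP => a i.
(* Entry [(a, j)] of the commutation with the matrix unit at [(i, j)] says that [W a i] is [W j j]
   if [a = i] and zero otherwise. *)
have /matrixP /(_ a j) := WB (delta_mx i j).
rewrite !mxE (bigD1 i)//= !mxE !eqxx mulr1 big1 ?addr0; last first.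
  by move=> k /negbTE ki; rewrite !mxE ki mulr0.
move=> ->; rewrite (bigD1 j)//= !mxE !eqxx andbT big1 ?addr0; last first.
  by move=> k /negbTE kj; rewrite !mxE kj andbF mul0r.
by rewrite mulr_natl.
Qed.

(** A nonzero determinant makes every matrix a combination of words. A matrix commuting with both
    letters commutes with every word, hence is central. *)
Lemma sandwich_commutant rho sigma W :
  sandwich_det rho sigma != 0 ->
  W *m rho = rho *m W -> W *m sigma = sigma *m W -> exists c, W = c%:M.
Proof.
rewrite -unitfE -unitmxE => uL Wr Ws; apply: scalar_mx_commute => B.
pose C := vec_mx (mxvec B *m invmx (lin_mx (sandwich rho sigma))).
have <- : sandwich rho sigma C = B.
  by rewrite /C -mx_rV_lin mulmxKV// mxvecK.
have WX k : W *m rho ^+ k = rho ^+ k *m W.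
  elim: k => [|k IH]; first by rewrite !expr0 mulmx1 mul1mx.
  by rewrite exprS -mulmxA -IH !mulmxA Wr.
rewrite /sandwich mulmx_sumr mulmx_suml; apply: eq_bigr => i _.
rewrite mulmx_sumr mulmx_suml; apply: eq_bigr => j _.
rewrite -scalemxAr -scalemxAl !mulmxA WX -!mulmxA -WX.
by congr (_ *: (_ *m _)); rewrite !mulmxA Ws.
Qed.

Lemma exprZmx (a : F) rho k : (a *: rho) ^+ k = a ^+ k *: rho ^+ k.
Proof.
elim: k => [|k IH]; first by rewrite !expr0 scale1r.
by rewrite !exprS IH; rewrite -[LHS]scalemxAl -scalemxAr scalerA -exprS.
Qed.

(** Rescaling multiplies each word by a nonzero factor, which the coefficients can absorb. This
    passes from Gram matrices to their normalized versions. *)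
Lemma sandwich_detZ (a b : F) rho sigma : a != 0 -> b != 0 ->
  sandwich_det rho sigma != 0 -> sandwich_det (a *: rho) (b *: sigma) != 0.
Proof.
move=> a0 b0 /sandwich_detP inj; apply/sandwich_detP => C C0.
pose D := \matrix_(i, j) (a ^+ i * b * a ^+ j * C i j).
have /inj D0 : sandwich rho sigma D = 0.
  rewrite -C0; apply: eq_bigr => i _; apply: eq_bigr => j _.
  rewrite !exprZmx -!scalemxAl -!scalemxAr -!scalemxAl !scalerA mxE.
  by congr (_ *: _); ring.
apply/matrixP => i j; have /matrixP/(_ i j) := D0; rewrite !mxE => /eqP.
by rewrite !mulf_eq0 !expf_eq0 (negbTE a0) (negbTE b0) !andbF /= => /eqP.
Qed.

(* In an eigenbasis of [rho] the (a, b) entry of a sandwich word is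
   p(d_a, d_b) * c, where p ranges over the polynomials in two variables of
   degree < N in each. *)
Lemma sandwich_det_diag (d : 'rV[F]_N) (c : F) :
  injective (d 0) -> c != 0 -> sandwich_det (diag_mx d) (const_mx c) != 0.
Proof.
move=> dinj c0; apply/sandwich_detP => C C0.
pose V := Vandermonde N d.
have uV : V \in unitmx.
  rewrite unitmxE det_Vandermonde unitfE; apply/prodf_neq0 => i _.
  apply/prodf_neq0 => j ij; rewrite subr_eq0; apply/eqP => /dinj ji.
  by rewrite ji ltnn in ij.
have diagX k : diag_mx d ^+ k = diag_mx (\row_j d 0 j ^+ k).
  elim: k => [|k IH].
    apply/matrixP => i j; rewrite expr0 !mxE expr0.
    by [].
  rewrite exprS IH; rewrite [LHS]mulmx_diag; congr diag_mx.
  by apply/rowP => j; rewrite !mxE exprS.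
(* Up to the factor [c], the entries of the sandwich are those of [V^T C V]; since the Vandermonde
   matrix is invertible, [C] must vanish. *)
have : V^T *m C *m V = 0.
  apply/matrixP => a b.
  have : sandwich (diag_mx d) (const_mx c) C a b =
      c * \sum_i \sum_j (V i a * C i j * V j b).
    rewrite summxE mulr_sumr; apply: eq_bigr => i _.
    rewrite summxE mulr_sumr; apply: eq_bigr => j _.
    by rewrite !diagX mul_diag_mx mul_mx_diag !mxE; ring.
  rewrite C0 mxE => /esym/eqP; rewrite mulf_eq0 (negbTE c0) /= => /eqP VCV.
  rewrite -[RHS]VCV exchange_big [LHS]mxE /=; apply: eq_bigr => j _.
  rewrite [X in X * _]mxE mulr_suml; apply: eq_bigr => i _.
  by rewrite [V^T _ _]mxE.
move=> /(congr1 (fun X => X *m invmx V)); rewrite mulmxK// mul0mx.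
move=> /(congr1 (fun X => invmx V^T *m X)); rewrite mulKmx ?unitmx_tr//.
by rewrite mulmx0.
Qed.

End sandwich_words.

(** * Polynomial dependence of the word determinant *)

Section sandwich_poly.
Context (R : realType) (m n N : nat).

Lemma cmx_poly_sandwich_det (rho sigma : 'M[R[i]]_(m, n) -> 'M[R[i]]_N) :
  mxfun_poly rho -> mxfun_poly sigma ->
  cmx_poly (fun A => sandwich_det (rho A) (sigma A)).
Proof.
move=> prho psigma; apply: cmx_poly_det => k l.
case/mxvec_indexP: l => a b.
under eq_fun do rewrite !mxE /= mxvecE /sandwich summxE.
apply: cmx_poly_sum => i; under eq_fun do rewrite summxE.
apply: cmx_poly_sum => j; under eq_fun do rewrite mxE.
apply: cmx_polyM; first exact: cmx_poly_cst.
by apply: mxfun_polyM; [apply: mxfun_polyM => //|]; exact: mxfun_polyX.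
Qed.

End sandwich_poly.

(** * Gram matrices and their normalization *)

Section gram_matrices.
Context (R : realType).
Implicit Types m n N : nat.

Local Notation sqnorm z := (complex.Re z ^+ 2 + complex.Im z ^+ 2).

Lemma mulc_conj (z : R[i]) : z * z^* = Complex (sqnorm z) 0.
Proof.
case: z => a b; apply/eqP; rewrite eq_complex /=.
by apply/andP; split; apply/eqP; ring.
Qed.

Definition frobenius m n (A : 'M[R[i]]_(m, n)) : R :=
  \sum_i \sum_j sqnorm (A i j).

Lemma frobenius_ge0 m n (A : 'M[R[i]]_(m, n)) : 0 <= frobenius A.
Proof. by do 2!apply: sumr_ge0 => ? _; rewrite addr_ge0 ?sqr_ge0. Qed.

Lemma tr_gram m n (A : 'M[R[i]]_(m, n)) :
  \tr (A *m A^t*) = real_complex R (frobenius A).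
Proof.
rewrite /frobenius rmorph_sum; apply: eq_bigr => i _.
rewrite mxE rmorph_sum; apply: eq_bigr => j _.
by rewrite !mxE mulc_conj.
Qed.

Lemma frobenius_eq0 m n (A : 'M[R[i]]_(m, n)) : frobenius A = 0 -> A = 0.
Proof.
move=> A0; apply/matrixP => i j; apply/eqP; rewrite mxE -sqr_normc_eq0.
have h k : \sum_j sqnorm (A k j) == 0.
  move/eqP: A0; rewrite psumr_eq0 => [/allP/(_ k)|l _].
    by rewrite mem_index_enum => /(_ isT).
  by apply: sumr_ge0 => ? _; rewrite addr_ge0 ?sqr_ge0.
have := h i; rewrite psumr_eq0 => [/allP/(_ j)|l _].
  by rewrite mem_index_enum => /(_ isT).
by rewrite addr_ge0 ?sqr_ge0.
Qed.

Lemma mx_poly_frobenius m n :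
  mx_poly (fun A : 'M[R[i]]_(m, n) => frobenius A).
Proof.
apply: mx_poly_sum => i; apply: mx_poly_sum => j.
exact/cmx_poly_sqr_normc/cmx_poly_entry.
Qed.

Lemma mxfun_poly_gram m n p (F : 'M[R[i]]_(m, n) -> 'M[R[i]]_p) :
  mxfun_poly F -> mxfun_poly (fun A => F A *m (F A)^t*).
Proof. by move=> pF; apply: mxfun_polyM => //; exact: mxfun_poly_ctrmx. Qed.

Lemma normalized_gramE N (A : 'M[R[i]]_N) :
  normalized_gram A = real_complex R (frobenius A)^-1 *: (A *m A^t*).
Proof. by rewrite /normalized_gram tr_gram fmorphV. Qed.

Lemma mx_coordZ m n k (c : R) (B : 'M[R[i]]_(m, n)) :
  mx_coord k (real_complex R c *: B) = c * mx_coord k B.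
Proof.
rewrite /mx_coord mxE; case: (B k.1.1 k.1.2) => a b.
by case: k.2 => /=; ring.
Qed.

Lemma measurable_normalized_gram N :
  measurable_fun setT (@normalized_gram R N).
Proof.
apply: measurable_fun_mx => k; rewrite /comp.
(* The inverse is written as a real power, a measurable function; the two agree because
   [frobenius A] is nonnegative. *)
have -> : (fun A => mx_coord k (@normalized_gram R N A)) =
    (fun A => frobenius A `^ (-1) * mx_coord k (A *m A^t*)).
  apply/funext => A; rewrite powR_inv1 ?frobenius_ge0// normalized_gramE.
  exact: mx_coordZ.
apply: measurable_funM.
  have mf := measurable_mx_poly (@mx_poly_frobenius N N).
  exact: (measurableT_comp (@measurable_powR R (-1)) mf).
apply: measurable_mx_poly; rewrite /mx_coord.
have [h1 h2] := mxfun_poly_gram (@mxfun_poly_id R N N) k.1.1 k.1.2.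
by case: k.2.
Qed.

Lemma frobenius_unitmx N (A : 'M[R[i]]_N) : (0 < N)%N ->
  A \in unitmx -> frobenius A != 0.
Proof.
move=> N0 uA; apply/eqP => /frobenius_eq0 A0; move: uA.
by rewrite A0 unitmxE unitfE -(prednK N0) det0 eqxx.
Qed.

Lemma ctrmx_unitmx N (A : 'M[R[i]]_N) : (A^t* \in unitmx) = (A \in unitmx).
Proof. by rewrite map_unitmx unitmx_tr. Qed.

Lemma ctrmxM m n p (A : 'M[R[i]]_(m, n)) (B : 'M[R[i]]_(n, p)) :
  (A *m B)^t* = B^t* *m A^t*.
Proof. by rewrite trmx_mul map_mxM. Qed.

Lemma gram_ge0 m (x : 'rV[R[i]]_m) : 0 <= (x *m x^t*) 0 0.
Proof.
rewrite mxE; apply: sumr_ge0 => j _; rewrite !mxE mulc_conj lecE /= eqxx.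
by rewrite addr_ge0 ?sqr_ge0.
Qed.

Lemma normalized_gram_full_rank N (A : 'M[R[i]]_N) : (0 < N)%N ->
  A \in unitmx -> full_rank_density (normalized_gram A).
Proof.
move=> N0 uA; have A0 := frobenius_unitmx N0 uA.
have tA : real_complex R (frobenius A) != 0 by rewrite fmorph_eq0.
rewrite /full_rank_density normalized_gramE fmorphV; split; first split.
- rewrite linearZ map_mxZ ctrmxM trmxCK; congr (_ *: _).
  by rewrite -fmorphV; exact: conjc_real.
- move=> psi; rewrite -scalemxAr -scalemxAl mxE mulr_ge0//.
    by rewrite -fmorphV ler0c invr_ge0 frobenius_ge0.
  (* The quadratic form at [psi] is the squared norm of the row vector [psi^t* *m A]. *)
  have -> : psi^t* *m (A *m A^t*) *m psi = psi^t* *m A *m (psi^t* *m A)^t*.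
    by rewrite ctrmxM trmxCK !mulmxA.
  exact: gram_ge0.
- by rewrite linearZ /= tr_gram mulVf.
- rewrite mxrank_scale_nz ?invr_eq0// mxrank_unit//.
  by rewrite unitmx_mul ctrmx_unitmx uA.
Qed.

End gram_matrices.

(** * Null sets and full rank under the Hilbert-Schmidt measure *)

Section hilbert_schmidt_null_sets.
Context (R : realType) (N : nat) (HS : probability 'M[R[i]]_N R).
Hypothesis hHS : hilbert_schmidt HS.

(** Pulled back along the normalized Gram map, [S] lies in the zero set of [F], which is
    Ginibre-null because [A0] shows that [F] is not identically zero. *)
Lemma hilbert_schmidt_null (S : set 'M[R[i]]_N) (F : 'M[R[i]]_N -> R[i]) A0 :
  measurable S -> cmx_poly F -> F A0 != 0 ->
  (forall A, S (normalized_gram A) -> F A = 0) -> HS S = 0%E.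
Proof.
move=> mS pF F0 SF; have [G hG ->//] := hHS.
apply: (@subset_measure0 _ _ _ G _ [set A | F A = 0]) => //.
- rewrite -[X in measurable X]setTI.
  exact: measurable_normalized_gram.
- exact: measurable_cmx_poly_eq.
- exact: ginibre_cmx_poly_eq0 pF F0.
Qed.

(** The condition ranges over uncountably many vectors. For fixed [rho] the form is polynomial in
    [psi], so the countably many vectors with rational coordinates suffice. *)
Lemma measurable_psd : measurable [set rho : 'M[R[i]]_N |
  forall psi : 'cV[R[i]]_N, 0 <= (psi^t* *m rho *m psi) 0 0].
Proof.
pose v (f : {ffun 'I_N * 'I_1 * bool -> rat}) : 'cV[R[i]]_N :=
  \matrix_(i, j) Complex (ratr (f (i, j, true))) (ratr (f (i, j, false))).
pose Q (psi : 'cV[R[i]]_N) (rho : 'M[R[i]]_N) : R[i] :=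
  (psi^t* *m rho *m psi) 0 0.
rewrite (_ : [set rho | _] = ~` (\bigcup_f ~` [set rho | 0 <= Q (v f) rho])).
  apply: measurableC; apply: countable_bigcupT_measurable => [|f].
    exact: countableP.
  apply: measurableC.
  have [q1 q2] : cmx_poly (Q (v f)).
    apply: mxfun_polyM; last exact: mxfun_poly_cst.
    by apply: mxfun_polyM; [exact: mxfun_poly_cst|exact: mxfun_poly_id].
  rewrite (_ : [set rho | _] = [set rho | complex.Im (Q (v f) rho) = 0] `&`
      [set rho | 0 <= complex.Re (Q (v f) rho)]).
    apply: measurableI; first exact: measurable_mx_poly_eq.
    exact: measurable_mx_poly_ge0.
  apply/seteqP; split => rho; rewrite /= lecE /=.
    by move=> /andP[/eqP ? ?].
  by move=> [-> ->]; rewrite eqxx.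
rewrite setC_bigcup; apply/seteqP; split => rho /=.
  by move=> rho0 f _; rewrite setCK; exact: rho0.
move=> rho0.
have vP (psi : 'cV[R[i]]_N) :
    (forall k, exists q : rat, mx_coord k psi = ratr q) -> exists f, psi = v f.
  move=> /choice[q psiq]; exists [ffun k => q k]; apply: mx_coord_inj => k.
  by rewrite psiq /mx_coord mxE; case: k => [[i j] []] /=; rewrite ffunE.
have Qv psi : (forall k, exists q : rat, mx_coord k psi = ratr q) ->
    0 <= Q psi rho.
  by move=> /vP[f ->]; have := rho0 f I; rewrite setCK.
have [q1 q2] : cmx_poly (Q ^~ rho).
  apply: mxfun_polyM; last exact: mxfun_poly_id.
  apply: mxfun_polyM; last exact: mxfun_poly_cst.
  exact/mxfun_poly_ctrmx/mxfun_poly_id.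
move=> psi; rewrite -/(Q psi rho) lecE /=; apply/andP; split; last first.
  apply: (mx_poly_ge0_rat q1) => A /Qv; rewrite lecE /=.
  by move=> /andP[].
(* The order on complex numbers also requires a zero imaginary part, obtained by showing that it and
   its opposite are both nonnegative. *)
rewrite eq_le -oppr_ge0; apply/andP; split.
  apply: (mx_poly_ge0_rat (mx_polyN q2)) => A /Qv; rewrite lecE /=.
  by move=> /andP[/eqP-> _]; rewrite oppr0.
apply: (mx_poly_ge0_rat q2) => A /Qv; rewrite lecE /=.
by move=> /andP[/eqP-> _].
Qed.

Lemma measurable_full_rank_density :
  measurable [set rho : 'M[R[i]]_N | full_rank_density rho].
Proof.
rewrite (_ : [set rho | _] =
  [set rho | (rho^t* + -1 *: rho) = 0] `&` [set rho : 'M[R[i]]_N |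
    forall psi : 'cV[R[i]]_N, 0 <= (psi^t* *m rho *m psi) 0 0] `&`
  [set rho | \tr rho = 1] `&` ~` [set rho | \det rho = 0]).
  have pid := @mxfun_poly_id R N N.
  repeat apply: measurableI.
  - apply: measurable_mxfun_poly_eq => i j.
    under eq_fun do rewrite !mxE.
    apply: cmx_polyD; first exact/cmx_poly_conj/cmx_poly_entry.
    by apply: cmx_polyM; [exact: cmx_poly_cst|exact: cmx_poly_entry].
  - exact: measurable_psd.
  - by apply: measurable_cmx_poly_eq; exact: cmx_poly_tr pid.
  - apply: measurableC; apply: measurable_cmx_poly_eq.
    exact: cmx_poly_det pid.
have rankE (rho : 'M[R[i]]_N) : \rank rho = N <-> ~ (\det rho = 0).
  split=> [/eqP|/eqP].
    by rewrite -/(row_free rho) row_free_unit unitmxE unitfE => /eqP.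
  by rewrite -unitfE -unitmxE -row_free_unit => /eqP.
apply/seteqP; split => rho /=.
  move=> [[h1 h2 h3] /rankE h4]; do ![split=> //].
  by rewrite h1 scaleN1r subrr.
by move=> [[[/eqP]]]; rewrite scaleN1r subr_eq0 => /eqP h1 h2 h3 /rankE h4.
Qed.

Lemma hilbert_schmidt_full_rank : (0 < N)%N ->
  HS [set rho | ~ full_rank_density rho] = 0%E.
Proof.
move=> N0; apply: (@hilbert_schmidt_null _ (fun A => \det A) 1%:M).
- by apply: measurableC; exact: measurable_full_rank_density.
- by apply: cmx_poly_det; exact: mxfun_poly_id.
- by rewrite det1 oner_neq0.
- move=> A; apply: contra_notP => /eqP A0; exact: normalized_gram_full_rank.
Qed.

End hilbert_schmidt_null_sets.

(** * Almost every pair of density matrices is generic *)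

Section generic_pairs.
Context (R : realType) (N : nat) (HS : probability 'M[R[i]]_N R).
Hypothesis (N0 : (0 < N)%N) (hHS : hilbert_schmidt HS).

(** [sigma0] is a fixed reference: almost every [rho] is generic against it, and for such a [rho] it
    witnesses that the determinant does not vanish identically in [sigma]. *)
Let ones : 'M[R[i]]_N := const_mx 1.
Let sigma0 := ones *m ones^t*.

Lemma hilbert_schmidt_generic_r rho : sandwich_det rho sigma0 != 0 ->
  HS [set sigma | sandwich_det rho sigma = 0] = 0%E.
Proof.
move=> rho0.
(* The trace factor absorbs the matrices of zero trace, for which normalization is not a nonzero
   rescaling. *)
apply: (@hilbert_schmidt_null _ _ _ hHS _ (fun A => \tr (A *m A^t*) *
  sandwich_det rho (A *m A^t*)) (const_mx 1)).
- apply: measurable_cmx_poly_eq; apply: cmx_poly_sandwich_det.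
    exact: mxfun_poly_cst.
  exact: mxfun_poly_id.
- have pg := mxfun_poly_gram (@mxfun_poly_id R N N).
  apply: cmx_polyM; first exact: cmx_poly_tr.
  by apply: cmx_poly_sandwich_det => //; exact: mxfun_poly_cst.
- rewrite mulf_neq0// tr_gram fmorph_eq0; apply/eqP => /frobenius_eq0.
  move=> /matrixP/(_ (Ordinal N0) (Ordinal N0)); rewrite !mxE.
  by move/eqP; rewrite oner_eq0.
- move=> A /= SA; apply/eqP; rewrite mulf_eq0; have [//|tA /=] := eqVneq.
  apply: contraPT SA => sA; apply/eqP; rewrite -[rho]scale1r.
  by apply: sandwich_detZ; rewrite ?oner_neq0// invr_eq0.
Qed.

Lemma hilbert_schmidt_generic_l :
  HS [set rho | sandwich_det rho sigma0 = 0] = 0%E.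
Proof.
(* The Gram matrix of [diag_mx d] has the distinct eigenvalues [(j+1)^2]; the shift by one makes the
   first entry nonzero, and with it the trace. *)
pose d : 'rV[R[i]]_N := \row_j j.+1%:R.
apply: (@hilbert_schmidt_null _ _ _ hHS _ (fun A => \tr (A *m A^t*) *
  sandwich_det (A *m A^t*) sigma0) (diag_mx d)).
- apply: measurable_cmx_poly_eq; apply: cmx_poly_sandwich_det.
    exact: mxfun_poly_id.
  exact: mxfun_poly_cst.
- have pg := mxfun_poly_gram (@mxfun_poly_id R N N).
  apply: cmx_polyM; first exact: cmx_poly_tr.
  by apply: cmx_poly_sandwich_det => //; exact: mxfun_poly_cst.
- rewrite mulf_neq0//.
    rewrite tr_gram fmorph_eq0; apply/eqP => /frobenius_eq0.
    move=> /matrixP/(_ (Ordinal N0) (Ordinal N0)); rewrite !mxE eqxx.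
    by move/eqP; rewrite oner_eq0.
  have -> : diag_mx d *m (diag_mx d)^t* = diag_mx (\row_j ((j.+1 ^ 2)%N)%:R).
    rewrite tr_diag_mx map_diag_mx mulmx_diag; congr diag_mx.
    by apply/rowP => j; rewrite !mxE rmorph_nat natrX expr2.
  have -> : sigma0 = const_mx N%:R.
    apply/matrixP => i j; rewrite !mxE.
    under eq_bigr do rewrite !mxE rmorph1 mulr1.
    by rewrite sumr_const card_ord.
  apply: sandwich_det_diag; last by rewrite pnatr_eq0 -lt0n.
  move=> i j; rewrite !mxE => /eqP; rewrite eqr_nat eqn_exp2r// => /eqP[ij].
  exact: val_inj.
- move=> A /= SA; apply/eqP; rewrite mulf_eq0; have [//|tA /=] := eqVneq.
  apply: contraPT SA => sA; apply/eqP; rewrite -[sigma0]scale1r.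
  by apply: sandwich_detZ; rewrite ?oner_neq0// invr_eq0.
Qed.

Definition degenerate_pair (D : 'M[R[i]]_N * 'M[R[i]]_N) : Prop :=
  [\/ ~ full_rank_density D.1, ~ full_rank_density D.2 |
      sandwich_det D.1 D.2 = 0].

(** Gluing a pair into one matrix lets measurability of polynomial functions of a single matrix
    apply to pairs. *)
Lemma measurable_row_mx : measurable_fun setT
  (fun D : 'M[R[i]]_N * 'M[R[i]]_N => row_mx D.1 D.2).
Proof.
apply: measurable_fun_mx => -[[i j] b]; rewrite /comp /mx_coord /=.
case: (split_ordP j) => k ->.
- have mk := @measurable_mx_coord R N N (i, k, b).
  under eq_fun do rewrite row_mxEl.
  exact: (measurableT_comp mk measurable_fst).
- have mk := @measurable_mx_coord R N N (i, k, b).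
  under eq_fun do rewrite row_mxEr.
  exact: (measurableT_comp mk measurable_snd).
Qed.

Lemma measurable_degenerate_pair : measurable [set D | degenerate_pair D].
Proof.
have mfull : measurable [set rho : 'M[R[i]]_N | ~ full_rank_density rho].
  by apply: measurableC; exact: measurable_full_rank_density.
rewrite (_ : [set D | _] =
  setT `&` fst @^-1` [set rho | ~ full_rank_density rho] `|`
  setT `&` snd @^-1` [set rho | ~ full_rank_density rho] `|`
  setT `&` (fun D => row_mx D.1 D.2) @^-1`
    [set X | sandwich_det (lsubmx X) (rsubmx X) = 0]); last first.
  rewrite !setTI; apply/seteqP; split => D /=; rewrite row_mxKl row_mxKr.
    by move=> [?|?|?]; [left; left|left; right|right].
  by move=> [[?|?]|?]; [apply: Or31|apply: Or32|apply: Or33].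
apply: measurableU; first apply: measurableU.
- exact: measurable_fst.
- exact: measurable_snd.
- apply: measurable_row_mx => //; apply: measurable_cmx_poly_eq.
  by apply: cmx_poly_sandwich_det => i j; under eq_fun do rewrite mxE;
    exact: cmx_poly_entry.
Qed.

Lemma degenerate_pair_null :
  (HS \x HS)%E [set D | degenerate_pair D] = 0%E.
Proof.
have mfull : measurable [set rho : 'M[R[i]]_N | ~ full_rank_density rho].
  by apply: measurableC; exact: measurable_full_rank_density.
have msw (rho : 'M[R[i]]_N) :
    measurable [set sigma | sandwich_det rho sigma = 0].
  apply: measurable_cmx_poly_eq; apply: cmx_poly_sandwich_det.
    exact: mxfun_poly_cst.
  exact: mxfun_poly_id.
have msw0 : measurable [set rho : 'M[R[i]]_N | sandwich_det rho sigma0 = 0].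
  apply: measurable_cmx_poly_eq; apply: cmx_poly_sandwich_det.
    exact: mxfun_poly_id.
  exact: mxfun_poly_cst.
have HSU (A B : set 'M[R[i]]_N) : measurable A -> measurable B ->
    HS A = 0%E -> HS B = 0%E -> HS (A `|` B) = 0%E.
  by move=> mA mB A0 B0; rewrite (measureU0 mA mB B0).
have fr0 := hilbert_schmidt_full_rank hHS N0.
(* The product measure is the integral over [rho] of the measure of the section at [rho]; that
   section is null unless [rho] is singular or non-generic against [sigma0]. *)
apply: (@integral_null_support _ _ _ HS
  ([set rho | ~ full_rank_density rho] `|`
   [set rho | sandwich_det rho sigma0 = 0])).
- exact: measurableU.
- by apply: HSU => //; exact: hilbert_schmidt_generic_l.
move=> rho /not_orP[/contrapT frho /eqP rho0] /=.
apply: (@subset_measure0 _ _ _ HS _ ([set sigma | ~ full_rank_density sigma] `|`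
   [set sigma | sandwich_det rho sigma = 0])).
- by apply: measurable_xsection; exact: measurable_degenerate_pair.
- by apply: measurableU; [exact: mfull|exact: msw].
- by move=> sigma; rewrite /xsection /= inE => -[|?|?] //=; [left|right].
- apply: HSU; [exact: mfull|exact: msw|exact: fr0|].
  exact: hilbert_schmidt_generic_r.
Qed.

End generic_pairs.

(** * Perfect training, phases and the risk *)

Section risk.
Context (R : realType) (N : nat).
Hypothesis N0 : (0 < N)%N.

Lemma unitary_ctrmxM (U : 'M[R[i]]_N) : U \is unitarymx -> U^t* *m U = 1%:M.
Proof. by move=> /unitarymxP /mulmx1C. Qed.

Lemma measurable_unitary : measurable [set U : 'M[R[i]]_N | U \is unitarymx].
Proof.
rewrite (_ : [set U | _] = [set U | U *m U^t* = 1%:M]).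
  apply: measurable_mxfun_poly_eq; apply: mxfun_poly_gram.
  exact: mxfun_poly_id.
by apply/seteqP; split => U /unitarymxP.
Qed.

Lemma haar_pure_state_unit (om : probability 'cV[R[i]]_N R) :
  haar_pure_state om -> om (~` [set psi | psi^t* *m psi = 1%:M]) = 0%E.
Proof.
move=> [om1 _]; apply: probability_setC_eq0 om1.
apply: measurable_mxfun_poly_eq; apply: mxfun_polyM; last exact: mxfun_poly_id.
by apply: mxfun_poly_ctrmx; exact: mxfun_poly_id.
Qed.

Lemma sqr_normcE (z : R[i]) :
  Normc.normc z ^+ 2 = complex.Re z ^+ 2 + complex.Im z ^+ 2.
Proof. by case: z => a b; rewrite sqr_sqrtr// addr_ge0 ?sqr_ge0. Qed.

(** Unitarity of [c%:M] forces [c] to have modulus one, so the fidelity equals one at every unit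
    vector, hence almost everywhere. *)
Lemma quantum_risk_phase (om : probability 'cV[R[i]]_N R)
    (U V : 'M[R[i]]_N) (c : R[i]) :
  haar_pure_state om -> U \is unitarymx -> V \is unitarymx ->
  U^t* *m V = c%:M -> quantum_risk om U V = 0.
Proof.
move=> hom uU uV UV.
have c1 : Normc.normc c ^+ 2 = 1.
  have : c%:M *m (c%:M)^t* = 1%:M :> 'M[R[i]]_N.
    rewrite -UV ctrmxM trmxCK mulmxA mulmxtVK//.
    exact: unitary_ctrmxM.
  move=> /matrixP/(_ (Ordinal N0) (Ordinal N0)).
  rewrite tr_scalar_mx map_scalar_mx -scalar_mxM !mxE eqxx !mulr1n mulc_conj.
  by rewrite sqr_normcE => -[].
rewrite /quantum_risk /Rintegral; set I := (X in fine X).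
suff -> : I = 1%E by rewrite subrr.
rewrite -[RHS](probability_setT om) -[RHS]mul1e -integral_cst// /I.
under eq_integral do rewrite sqr_normcE.
have fE (psi : 'cV[R[i]]_N) :
    (psi^t* *m U^t* *m V *m psi) 0 0 = c * (psi^t* *m psi) 0 0.
  by rewrite -(mulmxA _ (U^t*)) UV mul_mx_scalar -scalemxAl mxE.
apply: ae_eq_integral => //.
- apply/measurable_EFinP; apply: measurable_mx_poly.
  apply: cmx_poly_sqr_normc; under eq_fun do rewrite fE.
  apply: cmx_polyM; first exact: cmx_poly_cst.
  apply: mxfun_polyM; last exact: mxfun_poly_id.
  by apply: mxfun_poly_ctrmx; exact: mxfun_poly_id.
- exists (~` [set psi | psi^t* *m psi = 1%:M]); split.
  + apply: measurableC.
    apply: measurable_mxfun_poly_eq.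
    apply: mxfun_polyM; last exact: mxfun_poly_id.
    by apply: mxfun_poly_ctrmx; exact: mxfun_poly_id.
  + exact: haar_pure_state_unit.
  + move=> psi /=; apply: contra_not => psi1 _.
    by rewrite -sqr_normcE fE psi1 mxE eqxx mulr1 c1.
Qed.

(** Multiplying the training identities by [V] on the right and [U^t*] on the left shows that
    [U^t* *m V] commutes with both states. *)
Lemma perfectly_trained_phase (U V rho sigma : 'M[R[i]]_N) :
  U \is unitarymx -> V \is unitarymx -> perfectly_trained U rho sigma V ->
  sandwich_det rho sigma != 0 -> exists c, U^t* *m V = c%:M.
Proof.
move=> uU uV [Vr Vs] /sandwich_commutant.
have UU := unitary_ctrmxM uU; have VV := unitary_ctrmxM uV.
have comm X : V *m X *m V^t* = U *m X *m U^t* ->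
    U^t* *m V *m X = X *m (U^t* *m V).
  move=> VX; have VXV : V *m X = U *m X *m U^t* *m V.
    by rewrite -VX -[RHS]mulmxA VV mulmx1.
  by rewrite -mulmxA VXV !mulmxA UU mul1mx.
by apply; exact: comm.
Qed.

End risk.

Theorem corollaryS6 (R : realType) (n : nat) (hn : (1 <= n)%N)
    (om : probability 'cV[R[i]]_(2 ^ n) R) (hom : haar_pure_state om)
    (HS : probability 'M[R[i]]_(2 ^ n) R) (hHS : hilbert_schmidt HS)
    (mu : probability 'M[R[i]]_(2 ^ n) R) (hmu : haar_unitary mu)
    (V : 'M[R[i]]_(2 ^ n) -> 'M[R[i]]_(2 ^ n) -> 'M[R[i]]_(2 ^ n) ->
         'M[R[i]]_(2 ^ n))
    (hV : forall U rho sigma : 'M[R[i]]_(2 ^ n),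
        U \is unitarymx -> full_rank_density rho -> full_rank_density sigma ->
        V U rho sigma \is unitarymx /\
        perfectly_trained U rho sigma (V U rho sigma)) :
  (\int[mu]_U \int[HS \x HS]_D (quantum_risk om U (V U D.1 D.2))%:E = 0)%E.
Proof.
have N0 : (0 < 2 ^ n)%N by rewrite expn_gt0.
(* The hypothesis on [V] says nothing for a non-unitary [U]; such matrices form a null set, and so
   do the degenerate pairs treated next. *)
apply: (@integral_null_support _ _ _ mu (~` [set U | U \is unitarymx])).
- by apply: measurableC; exact: measurable_unitary.
- by apply: probability_setC_eq0 hmu.1; exact: measurable_unitary.
move=> U /contrapT /= uU.
apply: (@integral_null_support _ _ _ (HS \x HS)%E [set D | degenerate_pair D]).
- exact: measurable_degenerate_pair.
- exact: degenerate_pair_null.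
move=> [rho sigma] /= nD; congr EFin.
have frho : full_rank_density rho.
  by apply: contrapT => h; apply: nD; exact: Or31.
have fsigma : full_rank_density sigma.
  by apply: contrapT => h; apply: nD; exact: Or32.
have d0 : sandwich_det rho sigma != 0.
  by apply/eqP => h; apply: nD; exact: Or33.
have [uV pt] := hV _ _ _ uU frho fsigma.
have [c UV] := perfectly_trained_phase uU uV pt d0.
exact: (quantum_risk_phase N0 hom uU uV UV).
Qed.
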